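(* Let $C:=\mathrm{Conv}\{\mathtt{PR},\mathtt P_0,\mathtt P_1\}$. Every box in $C\setminus\mathrm{Conv}\{\mathtt P_0,\mathtt P_1\}$ collapses communication complexity.
   Context: A non-signalling box is a function $\mathtt P:\{0,1\}^4\to[0,\infty)$, $\mathtt P(a,b|x,y)$, with $\sum_{a,b}\mathtt P(a,b|x,y)=1$ for all $x,y$, such that $\sum_b\mathtt P(a,b|x,y)$ does not depend on $y$ and $\sum_a\mathtt P(a,b|x,y)$ does not depend on $x$. Define $\mathtt{PR}(a,b|x,y)=\frac12\mathbf 1_{a\oplus b=xy}$, $\mathtt P_0(a,b|x,y)=\mathbf 1_{a=b=0}$, $\mathtt P_1(a,b|x,y)=\mathbf 1_{a=b=1}$. Collapse of communication complexity. Alice knows $X\in\{0,1\}^n$, Bob knows $Y\in\{0,1\}^m$, and they share randomness (a random variable $\lambda$ independent of $X,Y$) and finitely many, say $N$, independent copies of a box $\mathtt P$ (with $N$ arbitrary). Each party uses its own side of each copy once, in an order and with input bits that it chooses adaptively as a function of its string, $\lambda$, and the output bits it has already received; for fixed $\lambda,X,Y$, the probability of output bits $(a_i,b_i)_{i\le N}$ is $\prod_{i=1}^N\mathtt P(a_i,b_i|x_i,y_i)$, where $x_i$ (resp. $y_i$) is the input Alice (resp. Bob) gives to copy $i$ when her (resp. his) outputs are $(a_j)_j$ (resp. $(b_j)_j$). Then Bob sends one bit to Alice, computed from $Y,\lambda$ and his outputs, and Alice outputs a bit computed from $X,\lambda$, her outputs and the received bit. The box $\mathtt P$ collapses communication complexity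 (is collapsing) if there is a fixed $p>\frac12$ such that for all $n,m$ and every $f:\{0,1\}^n\times\{0,1\}^m\to\{0,1\}$ there is such a one-bit protocol using copies of $\mathtt P$ for which, for all $X,Y$, Alice outputs $f(X,Y)$ with probability at least $p$. *)

(* Defs.v *)
From mathcomp Require Export all_boot all_order all_algebra.
From mathcomp Require Export all_classical all_reals all_analysis.

Set Implicit Arguments.
Unset Strict Implicit.
Unset Printing Implicit Defensive.

Import Order.TTheory GRing.Theory Num.Theory.

Local Open Scope classical_set_scope.
Local Open Scope ring_scope.

(* [P a b x y] is the probability P(a,b|x,y). *)
Definition box (R : realType) := bool -> bool -> bool -> bool -> R.

Record nonsignalling (R : realType) (P : box R) : Prop := Nonsignalling {
  box_ge0 : forall a b x y, 0 <= P a b x y;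
  box_sum1 : forall x y, \sum_(a : bool) \sum_(b : bool) P a b x y = 1;
  box_margA : forall a x y y',
    \sum_(b : bool) P a b x y = \sum_(b : bool) P a b x y';
  box_margB : forall b x x' y,
    \sum_(a : bool) P a b x y = \sum_(a : bool) P a b x' y
}.

Definition PR (R : realType) : box R :=
  fun a b x y => (a (+) b == (x && y))%:R / 2.

Definition P0 (R : realType) : box R := fun a b _ _ => (~~ a && ~~ b)%:R.

Definition P1 (R : realType) : box R := fun a b _ _ => (a && b)%:R.

Definition Conv (R : realType) (S : set (box R)) : set (box R) :=
  [set P | exists (k : nat) (w : 'I_k -> R) (Q : 'I_k -> box R),
    [/\ forall i, 0 <= w i, \sum_(i < k) w i = 1, forall i, S (Q i) &
      forall a b x y, P a b x y = \sum_(i < k) w i * Q i a b x y]].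

(* In what follows [pick h] is the copy a party uses next once it has received *)
(* the outputs [h], listed chronologically (for a deterministic party, [h]     *)
(* determines the copies already used and their inputs), and [o] lists the     *)
(* outputs of the copies, indexed by copy.                                     *)
(* [received pick o k] is what the party has received after [k] uses.          *)
Fixpoint received (pick : seq bool -> nat) (o : seq bool) (k : nat) : seq bool :=
  if k is k'.+1 then
    let h := received pick o k' in rcons h (nth false o (pick h))
  else [::].

Definition copy_order (N : nat) (pick : seq bool -> nat) (o : seq bool) :
    seq nat :=
  mkseq (fun k => pick (received pick o k)) N.

(* [input_at N pick inp o i] is the input given to copy [i]: [inp] is          *)
(* evaluated at the outputs received just before copy [i] is used.             *)
Definition input_at (N : nat) (pick : seq bool -> nat) (inp : seq bool -> bool)
    (o : seq bool) (i : nat) : bool :=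
  inp (received pick o (index i (copy_order N pick o))).

(* One party's use of its side of the [N] copies, as a function of the shared *)
(* randomness, its [n]-bit string and the outputs received so far.            *)
Record strategy (d : measure_display) (L : measurableType d) (n N : nat) :=
  Strategy {
    pick_copy : L -> n.-tuple bool -> seq bool -> nat;
    pick_input : L -> n.-tuple bool -> seq bool -> bool;
    pick_copy_once : forall (l : L) (X : n.-tuple bool) (o : N.-tuple bool),
      perm_eq (copy_order N (pick_copy l X) o) (iota 0 N);
    measurable_pick_copy : forall (X : n.-tuple bool) (h : seq bool),
      measurable_fun [set: L] (fun l => pick_copy l X h);
    measurable_pick_input : forall (X : n.-tuple bool) (h : seq bool),
      measurable_fun [set: L] (fun l => pick_input l X h)
  }.

Record protocol (d : measure_display) (L : measurableType d) (n m N : nat) :=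
  Protocol {
    alice : strategy L n N;
    bob : strategy L m N;
    message : L -> m.-tuple bool -> N.-tuple bool -> bool;
    answer : L -> n.-tuple bool -> N.-tuple bool -> bool -> bool;
    measurable_message : forall (Y : m.-tuple bool) (b : N.-tuple bool),
      measurable_fun [set: L] (fun l => message l Y b);
    measurable_answer : forall (X : n.-tuple bool) (a : N.-tuple bool) (c : bool),
      measurable_fun [set: L] (fun l => answer l X a c)
  }.

Definition output_prob (R : realType) (P : box R) (d : measure_display)
    (L : measurableType d) (n m N : nat) (pi : protocol L n m N) (l : L)
    (X : n.-tuple bool) (Y : m.-tuple bool) (a b : N.-tuple bool) : R :=
  \prod_(i < N) P (tnth a i) (tnth b i)
    (input_at N (pick_copy (alice pi) l X) (pick_input (alice pi) l X) a i)
    (input_at N (pick_copy (bob pi) l Y) (pick_input (bob pi) l Y) b i).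

(* The law [mu] of the shared randomness depends on neither [X] nor [Y]. *)
Definition answer_prob (R : realType) (P : box R) (d : measure_display)
    (L : measurableType d) (mu : probability L R) (n m N : nat)
    (pi : protocol L n m N) (X : n.-tuple bool) (Y : m.-tuple bool) (v : bool) :
    \bar R :=
  (\int[mu]_l
    (\sum_(a : N.-tuple bool)
      \sum_(b : N.-tuple bool | answer pi l X a (message pi l Y b) == v)
        output_prob P pi l X Y a b)%:E)%E.

Definition collapsing (R : realType) (P : box R) : Prop :=
  exists p : R, 2^-1 < p /\
    forall (n m : nat) (f : n.-tuple bool -> m.-tuple bool -> bool),
    exists (d : measure_display) (L : measurableType d) (mu : probability L R)
      (N : nat) (pi : protocol L n m N),
    forall (X : n.-tuple bool) (Y : m.-tuple bool),
      (p%:E <= answer_prob P mu pi X Y (f X Y))%E.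

(* Main.v *)
(* A box P of the triangle satisfies a (+) b = T x y with a hidden bit T that *)
(* is 1 with probability s > 0.  Write f(X, Y) as the sum over all strings u  *)
(* of [X = u] f(u, Y), and use one copy of P per u with inputs [X = u] and    *)
(* f(u, Y): the parity of all the outputs is f(X, Y) T, where T is the hidden *)
(* bit of the copy u = X, because all other terms have x = 0.  Bob sends the  *)
(* parity of his outputs, so Alice computes f(X, Y) T, which is wrong only    *)
(* when f(X, Y) = 1.  A shared biased coin telling Alice to answer 1 anyway   *)
(* balances this one-sided error and gives success probability 1 / (2 - s).   *)
Require Import Defs.
From mathcomp Require Import lra ring.

Set Implicit Arguments.
Unset Strict Implicit.
Unset Printing Implicit Defensive.

Import Order.TTheory GRing.Theory Num.Theory.

Local Open Scope classical_set_scope.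
Local Open Scope ring_scope.

(** The argument needs only two features of the box: outputs agree surely unless [x = y = 1], and
    [P true false true true > 0]. [parity_prob] reduces the total parity to one copy, and
    [onesided_collapsing] adds the coin. In the triangle the second feature says exactly that [PR]
    has positive weight. *)

Lemma sum_tuple_prod (R : comPzSemiRingType) (T : finType) (N : nat)
    (F : 'I_N -> T -> R) :
  \sum_(t : N.-tuple T) \prod_(i < N) F i (tnth t i) =
  \prod_(i < N) \sum_(z : T) F i z.
Proof.
rewrite bigA_distr_bigA (reindex (@finfun_of_tuple T N)) /=; last first.
  exists (@tuple_of_finfun T N) => t _.
    exact: finfun_of_tupleK.
  exact: tuple_of_finfunK.
by apply: eq_bigr => t _; apply: eq_bigr => i _; rewrite ffunE.
Qed.

Lemma sum_tuple2_prod (R : comPzSemiRingType) (S T : finType) (N : nat)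
    (F : 'I_N -> S -> T -> R) :
  \sum_(a : N.-tuple S) \sum_(b : N.-tuple T)
    \prod_(i < N) F i (tnth a i) (tnth b i) =
  \prod_(i < N) \sum_(a : S) \sum_(b : T) F i a b.
Proof.
under eq_bigr => a _ do rewrite (sum_tuple_prod (fun i => F i (tnth a i))).
exact: (sum_tuple_prod (fun i a => \sum_b F i a b)).
Qed.

Lemma size_received (pick : seq bool -> nat) (o : seq bool) (k : nat) :
  size (received pick o k) = k.
Proof. by elim: k => //= k IHk; rewrite size_rcons IHk. Qed.

Lemma copy_order_size (N : nat) (o : seq bool) :
  copy_order N size o = iota 0 N.
Proof.
rewrite /copy_order -[RHS]map_id; apply: eq_map => k; exact: size_received.
Qed.

Lemma input_at_size (N : nat) (inp : nat -> bool) (o : seq bool) (i : nat) :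
  (i < N)%N -> input_at N size (inp \o size) o i = inp i.
Proof.
move=> iN; rewrite /input_at copy_order_size /= size_received; congr inp.
by rewrite -{1}[i]add0n -(nth_iota 0 0 iN) index_uniq ?size_iota ?iota_uniq.
Qed.

(** A history's length counts the uses so far, so picking copy [size h] means using the copies in
    index order. *)
Definition nonadaptive (d : measure_display) (L : measurableType d) (n N : nat)
    (inp : n.-tuple bool -> nat -> bool) : strategy L n N.
Proof.
apply: (@Strategy _ L n N (fun _ _ => size) (fun _ X => inp X \o size)) => //.
by move=> l X o; rewrite copy_order_size.
Defined.

Section OneSidedBox.
Context (R : realType) (P : box R).
Hypothesis hP : nonsignalling P.
Hypothesis agreeP : forall a b x y, a (+) b -> ~~ (x && y) -> P a b x y = 0.

Definition parity (N : nat) (o : N.-tuple bool) : bool :=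
  \big[addb/false]_(i < N) tnth o i.

Lemma parity_prob (N : nat) (x y : 'I_N -> bool) (k : 'I_N) (v : bool) :
  (forall i, i != k -> x i = false) ->
  \sum_(a : N.-tuple bool)
    \sum_(b : N.-tuple bool | parity a (+) parity b == v)
      \prod_(i < N) P (tnth a i) (tnth b i) (x i) (y i) =
  \sum_(a : bool) \sum_(b : bool | a (+) b == v) P a b (x k) (y k).
Proof.
move=> x0.
(* Outside copy [k], unequal outputs have probability zero, so the global parity condition can be
   moved into the factor at [k]; the sum then factorizes over copies. *)
pose G i a b := if (i == k) ==> (a (+) b == v) then P a b (x i) (y i) else 0.
transitivity (\sum_(a : N.-tuple bool) \sum_(b : N.-tuple bool)
    \prod_(i < N) G i (tnth a i) (tnth b i)).
  apply: eq_bigr => a _; rewrite big_mkcond; apply: eq_bigr => b _.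
  case: (pickP [pred i | (i != k) && (tnth a i (+) tnth b i)]) => [i|nodiff].
    move=> /andP[/[dup] ik /x0 xi0 abi].
    rewrite (bigD1 i) //= [in RHS](bigD1 i) //= /G (negbTE ik) /=.
    by rewrite agreeP ?xi0 // !mul0r if_same.
  have -> : parity a (+) parity b = tnth a k (+) tnth b k.
    rewrite /parity -big_split (bigD1 k) //= big1 ?addbF // => i ik.
    by have := nodiff i; rewrite /= ik.
  rewrite (bigD1 k) //= [in RHS](bigD1 k) //= {1}/G eqxx /=.
  rewrite (eq_bigr (fun i => G i (tnth a i) (tnth b i))); last first.
    by move=> i ik; rewrite /G (negbTE ik).
  by case: ifP => //; rewrite mul0r.
rewrite sum_tuple2_prod (bigD1 k) //=.
rewrite [X in _ * X]big1 ?mulr1; last first.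
  by move=> i ik; rewrite /G (negbTE ik) /= (box_sum1 hP).
by apply: eq_bigr => a _; rewrite [RHS]big_mkcond /G eqxx.
Qed.

(** The shared randomness is the coin [l]; it can only force the answer to [true], since the parity
    errs only when [f X Y] is [true]. *)
Definition lookup_protocol (n m : nat)
    (f : n.-tuple bool -> m.-tuple bool -> bool) :
  protocol bool n m #|{: n.-tuple bool}|.
Proof.
pose u (k : nat) := nth (nseq_tuple n false) (enum {: n.-tuple bool}) k.
by apply: (@Protocol _ bool n m _
  (nonadaptive _ _ (fun X k => X == u k))
  (nonadaptive _ _ (fun Y k => f (u k) Y))
  (fun _ _ b => parity b) (fun l _ a c => l || (parity a (+) c))).
Defined.

Lemma lookup_output_prob (n m : nat)
    (f : n.-tuple bool -> m.-tuple bool -> bool) l X Y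
    (a b : #|{: n.-tuple bool}|.-tuple bool) :
  output_prob P (lookup_protocol f) l X Y a b =
  \prod_i P (tnth a i) (tnth b i) (X == enum_val i) (f (enum_val i) Y).
Proof.
apply: eq_bigr => i _ /=.
by rewrite !input_at_size // -!(enum_val_nth (nseq_tuple n false)).
Qed.

Lemma lookup_total_prob (n m : nat)
    (f : n.-tuple bool -> m.-tuple bool -> bool) l X Y :
  \sum_(a : #|{: n.-tuple bool}|.-tuple bool)
    \sum_(b : #|{: n.-tuple bool}|.-tuple bool)
      output_prob P (lookup_protocol f) l X Y a b = 1.
Proof.
under eq_bigr do under eq_bigr do rewrite lookup_output_prob.
rewrite (sum_tuple2_prod (fun i a b => P a b _ _)) big1 // => i _.
exact: box_sum1.
Qed.

(** Only copy [enum_rank X] gets input [true] from Alice, and Bob's input there is [f X Y]. *)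
Lemma lookup_parity_prob (n m : nat)
    (f : n.-tuple bool -> m.-tuple bool -> bool) l X Y :
  \sum_(a : #|{: n.-tuple bool}|.-tuple bool)
    \sum_(b : #|{: n.-tuple bool}|.-tuple bool |
      parity a (+) parity b == f X Y)
        output_prob P (lookup_protocol f) l X Y a b =
  if f X Y then P true false true true + P false true true true else 1.
Proof.
under eq_bigr do under eq_bigr do rewrite lookup_output_prob.
rewrite (@parity_prob _ _ _ (enum_rank X)); last first.
  by move=> i; apply: contraNF => /eqP ->; rewrite enum_valK.
rewrite enum_rankK eqxx; have := box_sum1 hP true false.
rewrite !big_bool ![X in _ -> X + _ = _]big_mkcond.
rewrite ![X in _ -> _ + X = _]big_mkcond !big_bool.
case: (f X Y) => /=.
  by rewrite add0r addr0.
by rewrite (agreeP (a := true) (b := false)) // (agreeP (a := false) (b := true)).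
Qed.

(* The coin bias [(1 - s) / (2 - s)] is the one for which both values of [f]  *)
(* are answered correctly with the same probability.                          *)
Lemma onesided_collapsing : 0 < P true false true true -> collapsing P.
Proof.
move=> P1011_gt0; pose s := P true false true true + P false true true true.
have P_ge0 := box_ge0 hP.
have s_gt0 : 0 < s by rewrite ltr_pwDl.
have s_le1 : s <= 1.
  rewrite -(box_sum1 hP true true) !big_bool /= /s.
  by have := P_ge0 true true true true; have := P_ge0 false false true true; lra.
pose t := (1 - s) / (2 - s).
have s2_gt0 : 0 < 2 - s by lra.
have t01 : 0 <= t <= 1.
  by rewrite /t divr_ge0 ?ler_pdivrMr //=; lra.
exists (2 - s)^-1; split; first by rewrite ltf_pV2 ?posrE //; lra.
move=> n m f; exists _, bool, (bernoulli_prob t), _, (lookup_protocol f) => X Y.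
rewrite /answer_prob integral_bernoulli_prob //; last first.
  move=> l; rewrite lee_fin; apply: sumr_ge0 => a _; apply: sumr_ge0 => b _.
  exact: prodr_ge0.
rewrite /= lookup_parity_prob -/s -!EFinM -EFinD lee_fin.
case fXY: (f X Y) => /=.
  rewrite lookup_total_prob /unstable.onem /t le_eqVlt; apply/orP; left; apply/eqP.
  by field; lra.
(* With [f X Y = false], the forced answer is always wrong: only the other coin value
   contributes. *)
under eq_bigr do rewrite big_pred0_eq.
rewrite big1 // /unstable.onem /t le_eqVlt; apply/orP; left; apply/eqP.
by field; lra.
Qed.

End OneSidedBox.

Theorem theorem23 (R : realType) (P : box R) (hP : nonsignalling P)
    (hC : (Conv [set PR R; P0 R; P1 R] `\` Conv [set P0 R; P1 R]) P) :
  collapsing P.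
Proof.
case: hC => -[k [w [Q [w_ge0 w_sum1 Q_gen PE]]]] notP01.
apply: onesided_collapsing => //.
  move=> a b x y ab /negbTE xy; rewrite PE big1 // => i _.
  by case: (Q_gen i) => [[]|] ->; rewrite /PR /P0 /P1 ?xy;
    case: a b ab => [] [] //= _; rewrite ?mul0r mulr0.
rewrite lt_neqAle box_ge0 // andbT eq_sym; apply/negP => /eqP P1011_0.
(* A vanishing sum of nonnegative terms vanishes termwise; as [PR] is positive at this entry, each
   of its occurrences has weight zero. *)
have wQ0 i : w i * Q i true false true true = 0.
  have Q_ge0 j : 0 <= Q j true false true true.
    by case: (Q_gen j) => [[]|] ->; rewrite /PR /P0 /P1 /= ?divr_ge0.
  move: P1011_0; rewrite PE => /eqP; rewrite psumr_eq0 => [/allP/(_ i)|j _].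
    by rewrite mem_index_enum => /(_ isT) /eqP.
  by rewrite mulr_ge0.
apply: notP01.
(* Generators of weight zero can be replaced by [P0] without changing the mixture, which removes
   every [PR]. *)
exists k, w, (fun i => if w i == 0 then P0 R else Q i); split => //.
  move=> i; case: eqP => [_|/eqP wi]; first by left.
  case: (Q_gen i) => [[QE|QE]|QE]; [|by left|by right].
  have /eqP := wQ0 i; rewrite QE mulf_eq0 (negbTE wi) /PR /= mul1r.
  by rewrite invr_eq0 pnatr_eq0.
move=> a b x y; rewrite PE; apply: eq_bigr => i _.
by case: eqP => // ->; rewrite !mul0r.
Qed.
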